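(* For an integer $a$, let $f_a(x) = x^6 + x^5 + (2a + 1)x^4 + (4a + 1)x^3 + (2a+1)x^2 + x + 1$, and let $\mathcal{L}_{f}(N)$ be the number of integers $a$ with $|a|\le N$ such that $f_a(x)$ is monogenic. Then there is a constant $c>0$ such that $\mathcal{L}_f(N) \geq c\, N/\log N$ for all sufficiently large $N$.
   Context: A monic irreducible polynomial $h(x)\in\mathbb{Z}[x]$ with root $\theta$ is monogenic if $\mathbb{Z}_K=\mathbb{Z}[\theta]$, where $\mathbb{Z}_K$ is the ring of integers of $K=\mathbb{Q}(\theta)$. *)

(* Defs.v *)
From mathcomp Require Import all_boot all_order all_algebra all_field finmap.
From mathcomp Require Import all_classical all_reals all_analysis.
Set Implicit Arguments.
Unset Strict Implicit.
Unset Printing Implicit Defensive.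
Import Order.TTheory GRing.Theory Num.Theory.
Local Open Scope ring_scope.
Local Open Scope fset_scope.
Local Open Scope classical_set_scope.

(* Q(theta), as a subfield of the algebraic numbers. *)
Definition Qadjoin (theta : algC) : set algC :=
  [set x | exists p q : {poly rat},
     (map_poly ratr q).[theta] != 0 /\
     x = (map_poly ratr p).[theta] / (map_poly ratr q).[theta]].

Definition ring_of_integers (K : set algC) : set algC :=
  [set x | K x /\ x \in Aint].

(* Z[theta] *)
Definition Zadjoin (theta : algC) : set algC :=
  [set x | exists p : {poly int}, x = (map_poly intr p).[theta]].

(* Divisibility in [{poly int}] is pseudo-divisibility (up to nonzero integer
   constants), so [irreducible_poly h] is irreducibility over Q (see
   [irreducible_rat_int]); for monic [h] this is irreducibility in Z[x], by
   Gauss's lemma.  The equality below does not depend on the choice of the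
   root, as the roots of [h] are conjugate. *)
Definition monogenic (h : {poly int}) : Prop :=
  [/\ h \is monic, irreducible_poly h &
      forall theta : algC, root (map_poly intr h) theta ->
        ring_of_integers (Qadjoin theta) = Zadjoin theta].

Definition f_ (a : int) : {poly int} :=
  'X^6 + 'X^5 + (2 * a + 1)%:P * 'X^4 + (4 * a + 1)%:P * 'X^3
  + (2 * a + 1)%:P * 'X^2 + 'X + 1.

(* [fset_set] is meaningful here because the set is finite. *)
Definition L_f (N : nat) : nat :=
  #|` fset_set [set a : int | `|a| <= N%:Z /\ monogenic (f_ a)]|.

(* Main.v *)
Require Import Defs.
From mathcomp Require Import all_boot all_order all_algebra all_field.
From mathcomp Require Import all_classical all_reals all_analysis.
From mathcomp Require Import ring lra zify.
Import Order.TTheory GRing.Theory Num.Theory.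

(* Put d = 8a+7 and Q = (2a+5)^2-32.  For a >= 0, comparing coefficients shows
   that f_a is irreducible.  By Dedekind's criterion it is then monogenic unless
   f_a lies in the square of a maximal ideal (p, q) of Z[x].  A prime p for which
   this happens must divide d or Q, because
       4 f_a = A^2 + d B^2,   A = (x-1)(2x^2+3x+2),   B = x(x+1),
   and the Wronskian A'B - AB' = 2V is such that Res(V, f_a) = Q^2.  The
   identity above, and the identity
       32 f_a = C^2 D + Q x^2 E   with u = 2a+5,
       C = 4x^2-(u-4)x+4,  D = 2x^2+(u-2)x+2,  E = 6x^2+(10-u)x+6,
   which lifts the double root of f_a modulo a divisor of Q, then show that p^2
   divides d or Q.  So f_a is monogenic as soon as d and Q are both squarefree.

   The a in [1, N] with this property have positive density.  An odd square p^2
   divides d for at most N/p^2 + 1 values of a, which excludes about N/4 of them.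
   A prime p with p^2 | Q is at least 7, and satisfies 4p <= 2a+5 or p = 7 since
   the cofactor is 1 mod 8 and not 9; as there are at most 2(N/p^2 + 1) values of
   a for each p, this excludes about N/6 + N/2.  *)

(** * Counting *)

(** Union bound, applied below with one predicate [P k] per sieving modulus. *)
Lemma count_has (T S : Type) (P : S -> pred T) ks s :
  (count (fun x => has (P^~ x) ks) s <= \sum_(k <- ks) count (P k) s)%N.
Proof.
elim: ks => [|k ks IHks]; first by rewrite big_nil /= count_pred0.
rewrite big_cons /= (leq_trans _ (leq_add (leqnn _) IHks)) //.
by rewrite -count_predUI leq_addr.
Qed.

(** Any [n] consecutive integers are covered by [n %/ M + 1] windows of length [M]. *)
Lemma count_window (P : pred nat) M c : (0 < M)%N ->
  (forall x, count P (iota x M) <= c)%N ->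
  forall n x, (count P (iota x n) <= c * (n %/ M).+1)%N.
Proof.
move=> M0 cP; elim/ltn_ind => n IHn x.
have [lt_nM|le_Mn] := ltnP n M.
  rewrite divn_small // muln1 (leq_trans _ (cP x)) //.
  by rewrite -(subnKC (ltnW lt_nM)) iotaD count_cat leq_addr.
rewrite -{1}(subnKC le_Mn) iotaD count_cat.
rewrite -{2}(subnK le_Mn) divnDr // divnn M0 addn1 mulnS leq_add ?IHn //.
by lia.
Qed.

Lemma count_le1 (T : eqType) (P : pred T) s : uniq s ->
  {in s &, forall x y, P x -> P y -> x = y} -> (count P s <= 1)%N.
Proof.
move=> us Ps; rewrite -size_filter; have := filter_uniq P us.
have := mem_filter P ^~ s.
case: seq.filter => [|x [|y l]] //= memP; have := memP x; have := memP y.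
rewrite !inE !eqxx orbT => /esym/andP[Py sy] /esym/andP[Px sx].
by rewrite (Ps x y sx sy Px Py) eqxx.
Qed.

Lemma count_le2 (T : eqType) (P : pred T) s : uniq s ->
  {in s & &, forall x y z, P x -> P y -> P z -> [\/ x = y, y = z | x = z]} ->
  (count P s <= 2)%N.
Proof.
move=> us Ps; rewrite -size_filter; have := filter_uniq P us.
have := mem_filter P ^~ s.
case: seq.filter => [|x [|y [|z l]]] //= memP.
have := memP x; have := memP y; have := memP z.
rewrite !inE !eqxx !orbT => /esym/andP[Pz sz] /esym/andP[Py sy] /esym/andP[Px sx].
by have [->|->|->] := Ps x y z sx sy sz Px Py Pz; rewrite eqxx ?orbT ?andbF.
Qed.

(** * Solutions of the two congruences modulo an odd square *)

Lemma dvdn_sub_window M i j : (i < j < i + M)%N -> (M %| j - i)%N = false.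
Proof. by move=> ij; apply: gtnNdvd; lia. Qed.

(** As [d] is odd, 8 is invertible modulo [d ^ 2], so two solutions differ by a multiple of
    [d ^ 2]. *)
Lemma count_sqr_dvdn_linear d x : odd d ->
  (count (fun i => d ^ 2 %| 8 * i + 15) (iota x (d ^ 2)) <= 1)%N.
Proof.
move=> d_odd; apply: count_le1; first exact: iota_uniq.
move=> i j; rewrite !mem_iota.
wlog le_ij : i j / (i <= j)%N => [wl|].
  by case: (leqP i j) => [/wl//|/ltnW/wl w] ix jx di dj; apply/esym/w.
move=> ix jx di dj.
have : (d ^ 2 %| 8 * (j - i))%N.
  by rewrite (_ : 8 * _ = 8 * j + 15 - (8 * i + 15))%N ?dvdn_sub //; lia.
rewrite Gauss_dvdr; last by rewrite coprimeXl // (@coprimeXr 3 _ 2) // coprimen2.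
have [ij|ij|//] := ltngtP i j; last by rewrite leqNgt ij in le_ij.
rewrite dvdn_sub_window // ij /=; move: ix jx => /andP[xi _] /andP[_ jx].
by rewrite (leq_trans jx) // leq_add2r.
Qed.

(** Solutions [i < j] in the window give [p ^ 2 | 4 (j - i) (i + j + 7)]. A prime [p] dividing both
    [j - i] and [i + j + 7] would divide [2j + 7], hence 32; and [p ^ 2] does not divide [j - i]. So
    [p ^ 2 | i + j + 7]. For three solutions [i < j < k], subtracting gives [p ^ 2 | k - i], which
    is impossible in one window. *)
Lemma count_sqr_dvdn_quadratic p x : prime p -> odd p ->
  (count (fun i => p ^ 2 %| (2 * i + 7) ^ 2 - 32) (iota x (p ^ 2)) <= 2)%N.
Proof.
move=> p_pr p_odd; apply: count_le2; first exact: iota_uniq.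
move ME: (p ^ 2)%N => M.
have M2 : coprime M 2 by rewrite -ME coprimeXl // coprimen2.
have cM n : ~~ (p %| n)%N -> coprime M n.
  by move=> pn; rewrite -ME coprimeXl // prime_coprime.
have pM : (p %| M)%N by rewrite -ME dvdn_exp.
have ge32 k : (32 <= (2 * k + 7) ^ 2)%N.
  by rewrite (@leq_trans (7 ^ 2)) // leq_exp2r // leq_addl.
move: {ME} M M2 cM pM => M M2 cM pM.
have key i j : (M %| (2 * i + 7) ^ 2 - 32)%N -> (M %| (2 * j + 7) ^ 2 - 32)%N ->
    (i < j < i + M)%N -> (M %| i + j + 7)%N.
  move=> di dj ij; have [ij' _] := andP ij.
  have : (M %| (2 * j + 7) ^ 2 - 32 - ((2 * i + 7) ^ 2 - 32))%N by rewrite dvdn_sub.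
  rewrite (_ : _ - _ = 2 * (2 * ((j - i) * (i + j + 7))))%N; last first.
    rewrite subnBA ?ge32 // subnK ?ge32 // subn_sqr.
    have -> : (2 * j + 7 - (2 * i + 7) = 2 * (j - i))%N by clear -ij'; lia.
    have -> : (2 * j + 7 + (2 * i + 7) = 2 * (i + j + 7))%N by clear; lia.
    by rewrite mulnACA !mulnA.
  do 2![rewrite Gauss_dvdr //].
  have [pij|npij] := boolP (p %| i + j + 7)%N; last first.
    by rewrite Gauss_dvdl ?cM // dvdn_sub_window.
  have [pji|npji] := boolP (p %| j - i)%N; last by rewrite Gauss_dvdr ?cM.
  have pj : (p %| 2 * j + 7)%N.
    have -> : (2 * j + 7 = (i + j + 7) + (j - i))%N by clear -ij'; lia.
    by rewrite dvdn_add.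
  have : (p %| 32)%N.
    rewrite -(subKn (ge32 j)) dvdn_sub //; first by rewrite dvdn_exp.
    exact: dvdn_trans dj.
  rewrite -[32%N]/(2 ^ 5)%N Euclid_dvdX // dvdn_prime2 // => /andP[/eqP p2E _].
  by rewrite p2E in p_odd.
have key2 i j k : (M %| (2 * i + 7) ^ 2 - 32)%N -> (M %| (2 * j + 7) ^ 2 - 32)%N ->
    (M %| (2 * k + 7) ^ 2 - 32)%N -> (i < j)%N -> (j < k)%N -> (k < i + M)%N -> False.
  move=> di dj dk ij jk ki.
  have d1 : (M %| i + j + 7)%N by apply: key => //; clear -ij jk ki; lia.
  have d2 : (M %| j + k + 7)%N by apply: key => //; clear -ij jk ki; lia.
  have : (M %| k - i)%N.
    have -> : (k - i = j + k + 7 - (i + j + 7))%N by clear -ij jk; lia.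
    by rewrite dvdn_sub.
  by rewrite dvdn_sub_window // (ltn_trans ij jk).
have win i j : (x <= i < x + M)%N -> (x <= j < x + M)%N -> (i < j + M)%N.
  by clear; lia.
move=> i j k; rewrite !mem_iota => ix jx kx di dj dk.
have [ij|ji|->] := ltngtP i j; last by constructor 1.
- have [jk|kj|->] := ltngtP j k; last by constructor 2.
    by case: (key2 i j k) => //; exact: win.
  have [ik|ki|->] := ltngtP i k; last by constructor 3.
    by case: (key2 i k j) => //; exact: win.
  by case: (key2 k i j) => //; exact: win.
- have [ik|ki|->] := ltngtP i k; last by constructor 3.
    by case: (key2 j i k) => //; exact: win.
  have [jk|kj|->] := ltngtP j k; last by constructor 2.
    by case: (key2 j k i) => //; exact: win.
  by case: (key2 k j i) => //; exact: win.
Qed.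

(** * Sieve estimates *)

Lemma ler_nat_divn (N d : nat) : (0 < d)%N -> ((N %/ d)%:R <= N%:R / d%:R :> rat)%R.
Proof. by move=> d0; rewrite ler_pdivlMr ?ltr0n // -natrM ler_nat leq_trunc_div. Qed.

(* Telescoping: 1/(2j+1)^2 <= (1/j - 1/(j+1))/4. *)
Lemma sum_divn_odd_sqr N m K : (0 < m)%N ->
  (4 * m * \sum_(k < K) N %/ (2 * (k + m) + 1) ^ 2 <= N)%N.
Proof.
move=> m0; set S := \sum_(k < K) _.
have : (S%:R <= N%:R * ((4 * m%:R)^-1 - (4 * (K + m)%:R)^-1) :> rat)%R.
  rewrite {}/S; elim: K => [|K IHK]; first by rewrite big_ord0 add0n subrr mulr0.
  rewrite big_ord_recr /= natrD.
  apply: (le_trans (lerD IHK (@ler_nat_divn N ((2 * (K + m) + 1) ^ 2) _))).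
    by rewrite expn_gt0 addn1.
  rewrite -mulrDr ler_wpM2l //.
  have : (0 < (K + m)%:R :> rat)%R by rewrite ltr0n addn_gt0 m0 orbT.
  have -> : (((2 * (K + m) + 1) ^ 2)%:R = (2 * (K + m)%:R + 1) ^+ 2 :> rat)%R.
    by rewrite natrX natrD natrM.
  rewrite addSn -[(K + m).+1%:R%R]natr1.
  move: (K + m)%:R%R => y y0.
  have -> : ((4 * m%:R)^-1 - (4 * (y + 1))^-1 =
    (4 * m%:R)^-1 - (4 * y)^-1 + (4 * (y * (y + 1)))^-1 :> rat)%R.
    by field; apply/and3P; split; rewrite ?pnatr_eq0 -?lt0n //; apply: lt0r_neq0; lra.
  rewrite lerD2l lef_pV2 ?posrE; nra.
move=> SN; rewrite -(ler_nat rat) mulnC natrM -ler_pdivlMr;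
  last by rewrite ltr0n muln_gt0.
apply: le_trans SN _; rewrite natrM ler_wpM2l // gerBl invr_ge0 mulr_ge0 //.
Qed.

(* From here on [a = i + 1], so that [8a + 7] and [2a + 5] become [8 * i + 15]
   and [2 * i + 7].  The bounds in [good] are such that [k < N %/ 100 + 200]
   whenever [(2k + 3)^2 <= 8N + 7], and [k < N %/ 4 + 1] whenever
   [4 * (2k + 7) <= 2N + 5] or [k = 0]. *)
Definition bad_linear K i :=
  has (fun k => (2 * (k + 1) + 1) ^ 2 %| 8 * i + 15)%N (index_iota 0 K).

Definition bad_quadratic K i :=
  has (fun k => prime (2 * (k + 3) + 1) &&
        ((2 * (k + 3) + 1) ^ 2 %| (2 * i + 7) ^ 2 - 32))%N (index_iota 0 K).

Lemma odd_2n1 n : odd (2 * n + 1).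
Proof. by rewrite addn1 /= oddM. Qed.

(** Telescoping from [m = 1] bounds the main terms by [N / 4]; the incomplete windows cost 1 for
    each of the [K] moduli. *)
Lemma count_bad_linear K N : (4 * count (bad_linear K) (iota 0 N) <= N + 4 * K)%N.
Proof.
pose P k i := (((2 * (k + 1) + 1) ^ 2 %| 8 * i + 15))%N.
have cP : (count (bad_linear K) (iota 0 N) <=
    \sum_(k < K) (N %/ (2 * (k + 1) + 1) ^ 2).+1)%N.
  apply: leq_trans (count_has _ _ P _ _) _.
  rewrite big_mkord; apply: leq_sum => k _; rewrite -[X in (_ <= X)%N]mul1n.
  apply: count_window; first by rewrite expn_gt0 addn1.
  by move=> x; apply: count_sqr_dvdn_linear; exact: odd_2n1.
have := sum_divn_odd_sqr N 1 K isT.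
move: cP; under eq_bigr do rewrite -addn1.
rewrite big_split /= sum_nat_const card_ord; set S := \sum_(k < K) _; lia.
Qed.

(** Telescoping from [m = 3] bounds the main terms by [2 * N / 12]; the incomplete windows cost 2
    for each of the [K] moduli. *)
Lemma count_bad_quadratic K N :
  (6 * count (bad_quadratic K) (iota 0 N) <= N + 12 * K)%N.
Proof.
pose P k i := (prime (2 * (k + 3) + 1) &&
  ((2 * (k + 3) + 1) ^ 2 %| (2 * i + 7) ^ 2 - 32))%N.
have cP : (count (bad_quadratic K) (iota 0 N) <=
    \sum_(k < K) 2 * (N %/ (2 * (k + 3) + 1) ^ 2).+1)%N.
  apply: leq_trans (count_has _ _ P _ _) _.
  rewrite big_mkord; apply: leq_sum => k _.
  apply: count_window; first by rewrite expn_gt0 addn1.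
  move=> x; rewrite /P; have [p_pr|_] /= := boolP (prime _); last by rewrite count_pred0.
  by apply: count_sqr_dvdn_quadratic => //; exact: odd_2n1.
have := sum_divn_odd_sqr N 3 K isT.
move: cP; rewrite -big_distrr /=; under eq_bigr do rewrite -addn1.
rewrite big_split /= sum_nat_const card_ord; set S := \sum_(k < K) _; lia.
Qed.

Definition good N i :=
  ~~ bad_linear (N %/ 100 + 200) i && ~~ bad_quadratic (N %/ 4 + 1) i.

(** The excluded proportion is [1/4 + 1/100] for the linear condition and [1/6 + 1/2] for the
    quadratic one, in total less than [93/100]. *)
Lemma count_good N :
  (100 * N <= 100 * count (good N) (iota 0 N) + 93 * N + 210 * 100)%N.
Proof.
have := count_bad_linear (N %/ 100 + 200) N.
have := count_bad_quadratic (N %/ 4 + 1) N.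
have : (count (predC (good N)) (iota 0 N) <=
    count (bad_linear (N %/ 100 + 200)) (iota 0 N) +
    count (bad_quadratic (N %/ 4 + 1)) (iota 0 N))%N.
  rewrite -count_predUI (leq_trans _ (leq_addr _ _)) //.
  by apply: sub_count => i; rewrite /= negb_and !negbK.
have := count_predC (good N) (iota 0 N); rewrite size_iota.
by lia.
Qed.

(** * Good indices give squarefree values *)

Lemma odd_sqr_mod8 n : odd n -> n ^ 2 = 1 %[mod 8].
Proof.
move=> n_odd; rewrite -modnXm; have : odd (n %% 8) by rewrite odd_mod.
have := ltn_pmod n (isT : 0 < 8)%N.
by case: (n %% 8)%N => [|[|[|[|[|[|[|[|]]]]]]]].
Qed.

Lemma good_linear N i p : (i < N)%N -> good N i -> prime p ->
  ~~ (p ^ 2 %| 8 * i + 15)%N.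
Proof.
move=> iN /andP[+ _] p_pr; apply: contra => pi.
have p_odd : odd p.
  have [p2|//] := even_prime p_pr.
  by move: pi; rewrite p2 -[(2 ^ 2)%N]/4%N; lia.
have p3 : (2 < p)%N by rewrite odd_prime_gt2.
have pE : (p = 2 * ((p - 3) %/ 2 + 1) + 1)%N by lia.
have le_p := dvdn_leq _ pi.
apply/hasP; exists ((p - 3) %/ 2)%N; last by rewrite -pE.
rewrite mem_index_iota /=.
have {le_p} : (p * p <= 8 * i + 15)%N by rewrite mulnn le_p // addnS.
(* An index out of range would give [2k + 3 > N/50 + 401], whose square exceeds [16N + 401^2],
   against [8i + 15 <= 8N + 7]. *)
by move: ((p - 3) %/ 2)%N pE => k ->; nia.
Qed.

Lemma sqr_mod3 n : (n ^ 2 %% 3 != 2)%N.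
Proof.
rewrite -modnXm; have := ltn_pmod n (isT : 0 < 3)%N.
by case: (n %% 3)%N => [|[|[|]]].
Qed.

Lemma sqr_mod5 n : (n ^ 2 %% 5 != 2)%N.
Proof.
rewrite -modnXm; have := ltn_pmod n (isT : 0 < 5)%N.
by case: (n %% 5)%N => [|[|[|[|[|]]]]].
Qed.

(* The cofactor [m] is 1 mod 8, and 9 is excluded mod 3: either [m = 1], which
   forces [p = 7], or [m >= 17]. *)
Lemma sqr_dvdn_small p u m : prime p -> odd u -> (6 < u)%N ->
  (u ^ 2 = m * p ^ 2 + 32)%N -> [/\ odd p, (6 < p)%N & (p <= 7)%N || (4 * p <= u)%N].
Proof.
move=> p_pr u_odd u6 uE.
have u8 := odd_sqr_mod8 u u_odd.
have p_odd : odd p.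
  have [p2|//] := even_prime p_pr.
  by have := congr1 odd uE; rewrite p2 oddX u_odd /= oddD oddM andbF.
have p8 := odd_sqr_mod8 p p_odd.
have m8 : (m %% 8 = 1)%N.
  have : (m * p ^ 2 = m %[mod 8])%N by rewrite -modnMmr p8 modnMmr muln1.
  by move: u8; rewrite uE; move: (m * p ^ 2)%N => x; clear; lia.
have p_gt6 : (6 < p)%N.
  (* 32 is 2 modulo 3 and modulo 5, and 2 is a square modulo neither. *)
  have p3 : p != 3%N.
    apply/eqP => p3; have := sqr_mod3 u; rewrite uE p3 -[(3 ^ 2)%N]/(3 * 3)%N; lia.
  have p5 : p != 5%N.
    apply/eqP => p5; have := sqr_mod5 u; rewrite uE p5 -[(5 ^ 2)%N]/(5 * 5)%N; lia.
  have := prime_gt1 p_pr; clear -p3 p5 p_odd; lia.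
split=> //; apply/orP.
have m9 : m != 9%N.
  by apply/eqP => m9; have := sqr_mod3 u; rewrite uE m9; lia.
have [m1|m17] : m = 1%N \/ (17 <= m)%N by clear -m8 m9; lia.
  left; move: uE; rewrite m1 -!mulnn => uE.
  have pu : (p < u)%N by clear -uE; nia.
  (* Both numbers are odd; the equation becomes [(k + 1) (p + k + 1) = 8], so [p > 6] leaves only
     [k = 0] and [p = 7]. *)
  have [k uk] : exists k, u = (p + 2 * k.+1)%N.
    by exists ((u - p) %/ 2 - 1)%N; clear -u_odd p_odd pu; lia.
  by move: uE; rewrite uk; clear; nia.
right; move: uE; rewrite -!mulnn => uE; clear -uE m17 p_gt6.
rewrite leqNgt; apply/negP => up.
have : (u * u < 4 * p * (4 * p))%N by nia.
nia.
Qed.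

Lemma good_quadratic N i p : (i < N)%N -> good N i -> prime p ->
  ~~ (p ^ 2 %| (2 * i + 7) ^ 2 - 32)%N.
Proof.
move=> iN /andP[_ +] p_pr; apply: contra => pi.
have [m mE] := dvdnP pi.
have ge32 : (32 <= (2 * i + 7) ^ 2)%N.
  by rewrite (@leq_trans (7 ^ 2)) // leq_exp2r // leq_addl.
have [|||p_odd p6 pu] := @sqr_dvdn_small p (2 * i + 7) m p_pr.
- by rewrite oddD oddM.
- by rewrite addnS ltnS leq_addl.
- by rewrite -mE subnK.
have pE : (p = 2 * ((p - 7) %/ 2 + 3) + 1)%N by clear -p_odd p6; lia.
apply/hasP; exists ((p - 7) %/ 2)%N; last by rewrite -pE p_pr.
rewrite mem_index_iota /=; clear -pu pE p6 iN; lia.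
Qed.

Local Open Scope ring_scope.
Local Open Scope classical_set_scope.

(** * Dedekind's criterion *)

Local Notation pZtoC := (map_poly (intr : int -> algC)).
Local Notation pZtoQ := (map_poly (intr : int -> rat)).
Local Notation pQtoC := (map_poly (ratr : rat -> algC)).
Local Notation red p := (map_poly (intr : int -> 'F_p)).

Lemma exists_irreducible_factor (F : fieldType) (e : {poly F}) :
  (1 < size e)%N -> exists2 q, irreducible_poly q & q %| e.
Proof.
have [n] := ubnP (size e); elim: n e => // n IHn e le_n e_gt1.
have [irr_e | red_e] := pselect (irreducible_poly e); first by exists e.
have e0 : e != 0 by rewrite -size_poly_gt0 (ltn_trans _ e_gt1).
have [q [q1 qe nqe]] : exists q : {poly F}, [/\ size q != 1%N, q %| e & ~~ (q %= e)].
  apply: contrapT => nq; apply: red_e; split=> // q q1 qe.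
  by apply: contrapT => /negP nqe; apply: nq; exists q; split.
have q0 : q != 0 by apply: contraNneq e0 => q0; rewrite -dvd0p -q0.
have lt_qe : (size q < size e)%N.
  by rewrite ltn_neqAle dvdp_leq // andbT dvdp_size_eqp.
have [||r irr_r rq] := IHn q.
- by rewrite (leq_trans lt_qe).
- by rewrite ltn_neqAle eq_sym q1 size_poly_gt0.
- by exists r => //; exact: dvdp_trans rq qe.
Qed.

Lemma irreducible_dvdpM (F : fieldType) (q s t : {poly F}) :
  irreducible_poly q -> q %| s * t -> (q %| s) || (q %| t).
Proof.
move=> irr_q; case: (boolP (q %| s)) => //= nqs.
by rewrite Gauss_dvdpr // irreducible_poly_coprime.
Qed.

Lemma irreducible_dvdpX (F : fieldType) (q s : {poly F}) n :
  irreducible_poly q -> q %| s ^+ n -> q %| s.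
Proof.
move=> irr_q; apply: contraLR => nqs.
rewrite -irreducible_poly_coprime // coprimep_expr //.
by rewrite irreducible_poly_coprime.
Qed.

Lemma red_surj p (P : {poly 'F_p}) : exists Q : {poly int}, red p Q = P.
Proof.
exists (map_poly (fun x : 'F_p => (x : nat)%:Z) P); apply/polyP => i.
by rewrite coef_map /= coef_map_id0 //= -pmulrn natr_Zp.
Qed.

Lemma intr_Fp_eq0 p (c : int) : prime p -> (c%:~R == 0 :> 'F_p) = (p %| c)%Z.
Proof. by move=> p_pr; rewrite -(dvdz_pcharf (pchar_Fp p_pr)). Qed.

Lemma red_eq0 p (P : {poly int}) : prime p -> red p P = 0 ->
  exists Q, P = p%:R * Q.
Proof.
move=> p_pr P0; exists (map_poly (fun c => (c %/ p)%Z) P); apply/polyP => i.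
rewrite -polyC_natr coefCM coef_map_id0 ?div0z // mulrC natz divzK //.
by rewrite -intr_Fp_eq0 // -coef_map P0 coef0.
Qed.

Lemma red_natr p : prime p -> red p p%:R = 0.
Proof. by move=> p_pr; rewrite rmorph_nat -polyC_natr (pcharf0 (pchar_Fp p_pr)). Qed.

Lemma red_eq p (P Q : {poly int}) : prime p -> red p P = red p Q ->
  exists S, P = Q + p%:R * S.
Proof.
move=> p_pr PQ; have [|S PQS] := @red_eq0 p (P - Q) p_pr.
  by rewrite rmorphB /= PQ subrr.
by exists S; rewrite -PQS addrC subrK.
Qed.

(** Content times leading coefficient of the primitive part is 1, so the content of a monic [f] is a
    unit, and pseudo-divisibility becomes divisibility by Gauss's lemma. *)
Lemma monic_dvdpP_int (f g : {poly int}) : f \is monic -> f %| g ->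
  exists h, g = f * h.
Proof.
move=> f_mon /dvdpP_int[h ->].
have c1 : zcontents f * lead_coef (zprimitive f) = 1.
  by rewrite -lead_coefZ -zpolyEprim (monicP f_mon).
exists (lead_coef (zprimitive f) *: h).
by rewrite {2}[f]zpolyEprim -scalerAr -scalerAl scalerA [_ * zcontents f]mulrC c1 scale1r.
Qed.

Lemma pQtoC_int (P : {poly int}) : pQtoC (pZtoQ P) = pZtoC P.
Proof. by rewrite -map_poly_comp; apply: eq_map_poly => x /=; rewrite ratr_int. Qed.

(** Over Q, [f] is associated to the minimal polynomial of [theta]. *)
Lemma irreducible_root_dvdp (f : {poly int}) (q : {poly rat}) theta :
  irreducible_poly f -> root (pZtoC f) theta ->
  root (pQtoC q) theta -> pZtoQ f %| q.
Proof.
move=> /irreducible_rat_int irr_f.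
have [m [mE m_mon] rm] := minCpolyP theta.
rewrite -pQtoC_int !rm => mf mq.
apply: dvdp_trans mq; have [_ /(_ m)] := irr_f.
rewrite /eqp mf /=; apply=> //.
have : (1 < size m)%N by have := size_minCpoly theta; rewrite mE size_map_poly.
by case: size => [|[]].
Qed.

Lemma irreducible_root_dvdp_int (f g : {poly int}) theta :
  f \is monic -> irreducible_poly f -> root (pZtoC f) theta ->
  root (pZtoC g) theta -> exists h, g = f * h.
Proof.
move=> f_mon irr_f rf rg; apply: monic_dvdpP_int => //.
by rewrite -dvdp_rat_int (@irreducible_root_dvdp _ _ theta) // pQtoC_int.
Qed.

Lemma Aint_int_poly (x : algC) : x \in Aint ->
  exists2 q : {poly int}, q \is monic & root (pZtoC q) x.
Proof.
move=> /floorpP[q qE]; exists q; last by rewrite -qE root_minCpoly.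
have := minCpoly_monic x; rewrite qE !monicE lead_coef_map_inj //; last exact: intr_inj.
by rewrite (eqr_int _ _ 1).
Qed.

Lemma Aint_root (f P : {poly int}) theta : f \is monic ->
  root (pZtoC f) theta -> (pZtoC P).[theta] \in Aint.
Proof.
move=> f_mon rf.
have th : theta \in Aint.
  apply: (@root_monic_Aint (pZtoC f)) => //; first exact: monic_map.
  by apply/polyOverP => i; rewrite coef_map /= intr_int.
apply: rpred_horner => //; apply/polyOverP => i.
by rewrite coef_map /= Aint_int ?intr_int.
Qed.

(* Clearing denominators in an integral equation of beta = t(theta)/s(theta). *)
Lemma integral_fraction (f s t : {poly int}) (theta beta : algC) :
  f \is monic -> irreducible_poly f -> root (pZtoC f) theta ->
  beta \in Aint -> (pZtoC s).[theta] * beta = (pZtoC t).[theta] ->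
  exists n g h, t ^+ n = s * g + f * h.
Proof.
move=> f_mon irr_f rf /Aint_int_poly[q q_mon rq] st.
pose m := (size q).-1.
(* With this [g], the value of [t ^+ m + s * g] at [theta] is [s(theta)^m q(beta) = 0], so [f]
   divides it. *)
pose g := \sum_(i < m) (q`_i)%:P * t ^+ i * s ^+ (m.-1 - i).
have szq : size q = m.+1.
  by rewrite prednK // size_poly_gt0 monic_neq0.
have [|h hE] := @irreducible_root_dvdp_int f (t ^+ m + s * g) theta f_mon irr_f rf.
  apply/rootP; rewrite rmorphD !rmorphM rmorphXn rmorph_sum /=.
  rewrite hornerD hornerM horner_exp horner_sum.
  have -> : (pZtoC s).[theta] *
      \sum_(i < m) (pZtoC ((q`_i)%:P * t ^+ i * s ^+ (m.-1 - i))).[theta]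
    = (pZtoC s).[theta] ^+ m * \sum_(i < m) (q`_i)%:~R * beta ^+ i.
    rewrite !mulr_sumr; apply: eq_bigr => i _.
    rewrite !rmorphM !rmorphXn /= map_polyC !hornerM !horner_exp hornerC -st.
    have mE x : x ^+ m = x ^+ i * x * x ^+ (m.-1 - i) :> algC.
      by rewrite -exprSr -exprD; congr (_ ^+ _); have := ltn_ord i; lia.
    by rewrite mE exprMn /=; ring.
  rewrite -st exprMn -mulrDr; apply/eqP; rewrite mulf_eq0; apply/orP; right.
  move/rootP: rq; rewrite (@horner_coef_wide _ m.+1) ?size_map_inj_poly ?szq //;
    last exact: intr_inj.
  rewrite big_ord_recr /= coef_map /= addrC.
  have := monicP q_mon; rewrite lead_coefE szq /= => -> /=.
  rewrite mul1r => qE; rewrite -[X in _ == X]qE; apply/eqP; congr (_ + _).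
  by apply: eq_bigr => i _; rewrite coef_map.
by exists m, (- g), h; rewrite -hE mulrN addrC addrK.
Qed.

(* Uchida's form of Dedekind's criterion: [f] does not lie in the square of the
   maximal ideal [(p, q)] of Z[x]. *)
Definition dedekind_at (f : {poly int}) (p : nat) : Prop :=
  forall q s t : {poly int}, f = q * s + p%:R * t ->
    irreducible_poly (red p q) -> red p q %| red p s -> ~~ (red p q %| red p t).

(** If [f] divides [P] modulo [p], the quotient by [p] is explicit. Otherwise [f / gcd(f, P)] has an
    irreducible factor [q] modulo [p], and [f = Q s + p t] with [s] a multiple of the gcd. An
    integral [beta] then has [p beta = s(theta)] and [Q beta = - t(theta)]; its integral equation
    forces [q] to divide [s] and [t] modulo [p], against the hypothesis. *)
Lemma dedekind_at_maximal (f P : {poly int}) p (theta alpha : algC) :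
  f \is monic -> irreducible_poly f -> root (pZtoC f) theta ->
  prime p -> dedekind_at f p ->
  alpha \in Aint -> p%:R * alpha = (pZtoC P).[theta] ->
  exists R : {poly int}, alpha = (pZtoC R).[theta].
Proof.
move=> f_mon irr_f rf p_pr ded_f Aalpha pP.
have p0 : p%:R != 0 :> algC by rewrite pnatr_eq0 -lt0n prime_gt0.
have fth : (pZtoC f).[theta] = 0 by apply/rootP.
case: (boolP (red p f %| red p P)) => [/dvdpP[h hE]|nfP].
  have [H HE] := red_surj p h.
  have [|S PE] := @red_eq p P (H * f) p_pr; first by rewrite rmorphM /= HE.
  exists S; apply: (mulfI p0); rewrite pP PE rmorphD !rmorphM /= rmorph_nat.
  by rewrite hornerD !hornerM fth mulr0 add0r -polyC_natr hornerC.
have f0 : red p f != 0 by rewrite monic_neq0 // monic_map.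
have [u [v dE]] : exists u v : {poly 'F_p},
    gcdp (red p f) (red p P) %= u * red p f + v * red p P.
  by have := egcdpE (red p f) (red p P); case: egcdp => u v; exists u, v.
set d := u * _ + _ in dE *.
have df : d %| red p f by rewrite -(eqp_dvdl _ dE) dvdp_gcdl.
have /dvdpP[e fE] := df.
(* If [e] were constant, [f] would divide [d], hence [P], modulo [p]. *)
have e_gt1 : (1 < size e)%N.
  rewrite ltnNge; apply: contra nfP => e1.
  suff : red p f %| d by move=> /dvdp_trans; apply; rewrite -(eqp_dvdl _ dE) dvdp_gcdr.
  
  move: e1; rewrite leq_eqVlt ltnS leqn0 size_poly_eq0.
  case/orP => [/size_poly1P[c c0 eE]|/eqP e0].
    by rewrite fE eE mul_polyC dvdpZl.
  by move: f0; rewrite fE e0 mul0r eqxx.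
have [q irr_q /dvdpP[c eE]] := exists_irreducible_factor _ e e_gt1.
have [Q QE] := red_surj p q; have [C CE] := red_surj p c.
have [U UE] := red_surj p u; have [V VE] := red_surj p v.
pose s := C * (U * f + V * P).
have [|t ft] := @red_eq p f (Q * s) p_pr.
  by rewrite !rmorphM rmorphD !rmorphM /= QE CE UE VE {1}fE eE -/d mulrA (mulrC q).
pose beta := (pZtoC C).[theta] * (pZtoC V).[theta] * alpha.
have Abeta : beta \in Aint by rewrite !rpredM // (Aint_root f).
have pbeta : (pZtoC p%:R).[theta] * beta = (pZtoC s).[theta].
  rewrite /s /beta !rmorphM rmorphD !rmorphM rmorph_nat /= !hornerM hornerD !hornerM.
  by rewrite fth -pP -polyC_natr hornerC; ring.
have Qbeta : (pZtoC Q).[theta] * beta = (pZtoC (- t)).[theta].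
  apply: (mulfI p0); rewrite mulrCA; move: pbeta.
  rewrite {1}rmorph_nat -{1}polyC_natr hornerC => ->.
  rewrite -hornerM -rmorphM; have -> : Q * s = f - p%:R * t by rewrite ft addrK.
  rewrite rmorphB !rmorphN !rmorphM rmorph_nat /= hornerD !hornerN hornerM fth.
  by rewrite -polyC_natr hornerC; ring.
have qf : q %| red p f by rewrite fE eE -mulrA mulrCA dvdp_mulIl.
have [n [g [h sn]]] := @integral_fraction f _ _ _ _ f_mon irr_f rf Abeta pbeta.
have [m [g' [h' tm]]] := @integral_fraction f _ _ _ _ f_mon irr_f rf Abeta Qbeta.
have qs : q %| red p s.
  apply: (irreducible_dvdpX _ q _ n irr_q).
  by rewrite -rmorphXn sn rmorphD !rmorphM /= red_natr // mul0r add0r dvdp_mulr.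
have qt : q %| red p t.
  rewrite -dvdpNr -rmorphN; apply: (irreducible_dvdpX _ q _ m irr_q).
  by rewrite -rmorphXn tm rmorphD !rmorphM /= QE dvdp_add ?dvdp_mulIl ?dvdp_mulr.
by have := ded_f Q s t ft; rewrite QE => /(_ irr_q qs); rewrite qt.
Qed.

(** An integral [x] in the field is a rational polynomial in [theta], so [n x] lies in Z[theta] for
    some [n > 0]. The primes of [n] are removed one at a time, applying the local statement to
    [(n / p) x]. *)
Theorem dedekind_criterion (f : {poly int}) :
  f \is monic -> irreducible_poly f ->
  (forall p, prime p -> dedekind_at f p) -> monogenic f.
Proof.
move=> f_mon irr_f ded_f; split=> // theta rf.
apply/seteqP; split=> [x [[P [q [q0 xE]]] Ax]|x [P ->]]; last first.
  split; last exact: Aint_root f_mon rf.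
  exists (pZtoQ P), 1; rewrite rmorph1 hornerC oner_neq0 divr1; split=> //.
  by rewrite pQtoC_int.
have [S xS] : exists S : {poly rat}, x = (pQtoC S).[theta].
  have : coprimep (pZtoQ f) q.
    rewrite irreducible_poly_coprime; last exact/irreducible_rat_int.
    apply: contra q0 => /dvdpP[h ->].
    by rewrite rmorphM /= hornerM pQtoC_int (rootP rf) mulr0.
  move=> /Bezout_eq1_coprimepP[[u v] /= uv]; exists (P * v).
  have vq : (pQtoC v).[theta] * (pQtoC q).[theta] = 1.
    have := congr1 (fun h => (pQtoC h).[theta]) uv.
    rewrite rmorphD !rmorphM /= rmorph1 hornerD !hornerM hornerC.
    by rewrite pQtoC_int (rootP rf) mulr0 add0r.
  by rewrite xE rmorphM hornerM -[_ / _]mulr1 -vq; field.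
have [n n0 [T nT]] : exists2 n : nat, (0 < n)%N &
    exists T : {poly int}, n%:R * x = (pZtoC T).[theta].
  have [T [a a0 SE]] := rat_poly_scale S.
  have aT : a%:~R * x = (pZtoC T).[theta].
    rewrite xS SE linearZ /= hornerZ pQtoC_int fmorphV mulrA /= ratr_int.
    by rewrite divff ?mul1r ?intr_eq0.
  case: a a0 {SE} aT => a a0 aT; first by exists a; rewrite ?lt0n //; exists T.
  exists a.+1 => //; exists (- T).
  by rewrite rmorphN hornerN -aT NegzE mulrNz mulNr opprK.
elim/ltn_ind: n T n0 x Ax nT {xE xS S P q q0} => n IHn T n0 x Ax nT.
have [n1|n_gt1] := leqP n 1.
  have nE : n = 1%N by lia.
  by exists T; rewrite -nT nE mul1r.
pose p := pdiv n; have p_pr : prime p by exact: pdiv_prime.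
have nE : n = (p * (n %/ p))%N by rewrite mulnC divnK ?pdiv_dvd.
have m0 : (0 < n %/ p)%N by rewrite divn_gt0 ?prime_gt0 ?pdiv_leq.
have [||R RE] := @dedekind_at_maximal f T p theta ((n %/ p)%:R * x)
  f_mon irr_f rf p_pr (ded_f p p_pr).
- by rewrite rpredM ?Aint_int // rpred_nat.
- by rewrite -nT mulrA -natrM -nE.
by apply: (IHn (n %/ p)%N _ R) => //; rewrite ltn_Pdiv ?prime_gt1.
Qed.

(** * The square of a maximal ideal of Z[x] *)

(* [in_max p q] and [in_max2 p q] are the ideal [(p, q)] of Z[x] and its square. *)
Definition in_max p (q P : {poly int}) := red p q %| red p P.

Definition in_max2 p (q P : {poly int}) :=
  exists X Y Z : {poly int}, P = q ^+ 2 * X + p%:R * q * Y + p%:R ^+ 2 * Z.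

Lemma in_maxD p q P Q : in_max p q P -> in_max p q Q -> in_max p q (P + Q).
Proof. by rewrite /in_max rmorphD; exact: dvdp_add. Qed.

Lemma in_maxMl p q P Q : in_max p q P -> in_max p q (Q * P).
Proof. by rewrite /in_max rmorphM; exact: dvdp_mull. Qed.

Lemma in_maxB p q P Q : in_max p q P -> in_max p q Q -> in_max p q (P - Q).
Proof. by rewrite /in_max rmorphB; exact: dvdp_sub. Qed.

Lemma in_max_p p q P : prime p -> in_max p q (p%:R * P).
Proof. by move=> p_pr; rewrite /in_max rmorphM /= red_natr // mul0r dvdp0. Qed.

Lemma in_max_prime p q P Q : irreducible_poly (red p q) ->
  in_max p q (P * Q) -> in_max p q P \/ in_max p q Q.
Proof.
by rewrite /in_max rmorphM => irr /(irreducible_dvdpM _ _ _ _ irr) /orP.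
Qed.

Lemma in_max_int p q (c : int) : prime p -> irreducible_poly (red p q) ->
  in_max p q c%:P -> (p %| c)%Z.
Proof.
move=> p_pr [q1 _]; rewrite /in_max map_polyC /= => qc.
rewrite -intr_Fp_eq0 //; apply: contraTT qc => c0.
by apply: contraL q1 => /dvdp_leq; rewrite polyC_eq0 size_polyC c0 -leqNgt => ->.
Qed.

Lemma in_max2Ml p q P Q : in_max2 p q P -> in_max2 p q (Q * P).
Proof. by move=> [X [Y [Z ->]]]; exists (Q * X), (Q * Y), (Q * Z); ring. Qed.

Lemma in_max2B p q P Q : in_max2 p q P -> in_max2 p q Q -> in_max2 p q (P - Q).
Proof.
move=> [X [Y [Z ->]]] [X' [Y' [Z' ->]]].
by exists (X - X'), (Y - Y'), (Z - Z'); ring.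
Qed.

Lemma in_maxP p q P : prime p -> in_max p q P ->
  exists X Y : {poly int}, P = q * X + p%:R * Y.
Proof.
move=> p_pr /dvdpP[h hE]; have [H HE] := red_surj p h.
have [|Y ->] := @red_eq p P (q * H) p_pr; last by exists H, Y.
by rewrite rmorphM /= HE mulrC.
Qed.

Lemma in_maxM2 p q P Q : prime p -> in_max p q P -> in_max p q Q ->
  in_max2 p q (P * Q).
Proof.
move=> p_pr /in_maxP[//|X [Y ->]] /in_maxP[//|X' [Y' ->]].
by exists (X * X'), (X * Y' + X' * Y), (Y * Y'); ring.
Qed.

Lemma in_max2W p q P : prime p -> in_max2 p q P -> in_max p q P.
Proof.
move=> p_pr [X [Y [Z ->]]]; apply: in_maxD; last first.
  by rewrite expr2 -mulrA in_max_p.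
apply: in_maxD; last by rewrite -mulrA in_max_p.
by rewrite /in_max rmorphM rmorphXn /= expr2 -mulrA dvdp_mulIl.
Qed.

Lemma in_max2_deriv p q P : prime p -> in_max2 p q P -> in_max p q (deriv P).
Proof.
move=> p_pr [X [Y [Z ->]]].
have -> : deriv (q ^+ 2 * X + p%:R * q * Y + p%:R ^+ 2 * Z) =
  (2 * deriv q * X + q * deriv X) * q + p%:R * (deriv q * Y + q * deriv Y + p%:R * deriv Z).
  by rewrite -!polyC_natr !poly.derivE; ring.
apply: in_maxD; last exact: in_max_p.
by apply: in_maxMl; rewrite /in_max dvdpp.
Qed.

(** Modulo [p] the relation says [q^2 X = 0], so [X] is a multiple of [p] and the whole relation can
    be divided by [p]. *)
Lemma in_max2_cancel p q P : prime p -> irreducible_poly (red p q) ->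
  in_max2 p q (p%:R * P) -> in_max p q P.
Proof.
move=> p_pr irr [X [Y [Z E]]].
have p0 : p%:R != 0 :> {poly int}.
  by rewrite -polyC_natr polyC_eq0 pnatr_eq0 -lt0n prime_gt0.
have [|X' XE] := @red_eq0 p X p_pr.
  have := congr1 (red p) E.
  rewrite !rmorphD !rmorphM /= red_natr // !mul0r !addr0.
  move=> /esym /eqP; rewrite !mulf_eq0 orbb.
  by rewrite (negPf (irredp_neq0 irr)) => /eqP.
have -> : P = (q * X' + Y) * q + p%:R * Z.
  by apply: (mulfI p0); rewrite E XE; ring.
apply: in_maxD; last exact: in_max_p.
by apply: in_maxMl; rewrite /in_max dvdpp.
Qed.

(** * Dedekind's criterion for [f_a] *)

Lemma f_E a : f_ a = 'X^6 + 'X^5 + (2 * a%:P + 1) * 'X^4 + (4 * a%:P + 1) * 'X^3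
  + (2 * a%:P + 1) * 'X^2 + 'X + 1.
Proof. by rewrite /f_ !rmorphD !rmorphM /=; ring. Qed.

Lemma f_deriv a : deriv (f_ a) = 6 * 'X^5 + 5 * 'X^4 + 4 * (2 * a%:P + 1) * 'X^3
  + 3 * (4 * a%:P + 1) * 'X^2 + 2 * (2 * a%:P + 1) * 'X + 1.
Proof. by rewrite f_E !poly.derivE; ring. Qed.

Lemma in_max_nat p q n : prime p -> irreducible_poly (red p q) ->
  in_max p q n%:R -> (p %| n)%N.
Proof.
by move=> p_pr irr; rewrite -polyC_natr natz => /(in_max_int _ _ _ p_pr irr).
Qed.

(** Turns a failure of [dedekind_at] into membership in the square of the ideal. *)
Lemma in_max2_split p q (f s t : {poly int}) : prime p ->
  f = q * s + p%:R * t -> in_max p q s -> in_max p q t -> in_max2 p q f.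
Proof.
move=> p_pr -> /in_maxP[//|s1 [s2 ->]] /in_maxP[//|t1 [t2 ->]].
by exists s1, (s2 + t1), t2; ring.
Qed.

(** Modulo 2, the derivative is [(x^2 + x + 1)^2] and [f_a] is [(x^4 + x)(x^2 + x + 1) + 1], so the
    two are coprime. *)
Lemma f_dedekind2 (a : int) : dedekind_at (f_ a) 2.
Proof.
move=> q s t fE irr qs; apply/negP => qt.
have p_pr : prime 2 by [].
have f2 := in_max2_split 2 q (f_ a) s t p_pr fE qs qt.
have f1 := in_max2W _ _ _ p_pr f2.
have f'1 := in_max2_deriv _ _ _ p_pr f2.
have c1 : in_max 2 q ('X^2 + 'X + 1).
  have : in_max 2 q (('X^2 + 'X + 1) * ('X^2 + 'X + 1)).
    rewrite (_ : _ * _ = deriv (f_ a) - 2%:R * (3 * 'X^5 + 2 * 'X^4 + (4 * a%:P + 1) * 'X^3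
      + 6 * a%:P * 'X^2 + 2 * a%:P * 'X)); last by rewrite f_deriv; ring.
    by apply: in_maxB => //; exact: in_max_p.
  by case/(in_max_prime _ _ _ _ irr).
suff /(in_max_nat _ _ 1 p_pr irr) : in_max 2 q 1%:R by [].
rewrite (_ : 1%:R = f_ a - ('X^4 + 'X) * ('X^2 + 'X + 1)
  - 2%:R * (a%:P * 'X^4 + 2 * a%:P * 'X^3 + a%:P * 'X^2)); last by rewrite f_E; ring.
by apply: in_maxB; [apply: in_maxB => //; exact: in_maxMl | exact: in_max_p].
Qed.

Lemma f_dedekind_odd (a : int) p : prime p -> p != 2%N ->
  ~~ (p%:Z ^+ 2 %| 8 * a + 7)%Z -> ~~ (p%:Z ^+ 2 %| (2 * a + 5) ^+ 2 - 32)%Z ->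
  dedekind_at (f_ a) p.
Proof.
move=> p_pr p_n2 sq1 sq2 q s t fE irr qs; apply/negP => qt.
have f2 := in_max2_split p q (f_ a) s t p_pr fE qs qt.
have f1 := in_max2W _ _ _ p_pr f2.
have f'1 := in_max2_deriv _ _ _ p_pr f2.
pose I := in_max p q.
have subI P Q x y : I P -> I Q -> I (x * P - y * Q).
  by move=> iP iQ; apply: in_maxB; exact: in_maxMl.
have prim P Q : I (P * Q) -> I P \/ I Q by exact: in_max_prime.
have n2 : ~ I 2.
  by move/(in_max_nat _ _ 2 p_pr irr); rewrite dvdn_prime2 //; exact/negP.
have n1 : ~ I 1.
  move/(in_max_nat _ _ 1 p_pr irr); rewrite dvdn1 => /eqP p1.
  by rewrite p1 in p_pr.
pose A : {poly int} := 2 * 'X^3 + 'X^2 - 'X - 2.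
pose B : {poly int} := 'X^2 + 'X.
pose d : {poly int} := 8 * a%:P + 7.
have fAB : 4 * f_ a = A * A + d * (B * B) by rewrite f_E /A /B /d; ring.
have nAB : I A -> ~ I B.
  move=> iA iB; apply: n2; rewrite (_ : 2 = (2 * 'X - 1) * B - 1 * A);
    last by rewrite /A /B; ring.
  exact: subI.
have intI c : I c%:P -> (p %| c)%Z by exact: in_max_int.
(* If [p | d], then [A] is in the ideal, so that [d B^2] is in its square: were
   [d/p] prime to [p], [B] would be in the ideal too. *)
have nd : ~ I d.
  move=> id.
  have dP : (8 * a + 7)%:P = d by rewrite /d rmorphD rmorphM /=; ring.
  have /intI/dvdzP[k dE] : I (8 * a + 7)%:P by rewrite dP.
  have iAA : I (A * A).
    rewrite (_ : _ * _ = 4 * f_ a - (B * B) * d); last by rewrite fAB; ring.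
    exact: subI.
  have iA : I A by case/prim: iAA.
  have : I (k%:P * (B * B)).
    apply: in_max2_cancel => //.
    rewrite (_ : _ * _ = 4 * f_ a - A * A).
      by apply: in_max2B; [exact: in_max2Ml | exact: in_maxM2].
    by rewrite fAB -dP dE polyCM -natz polyC_natr; ring.
  case/prim => [/intI/dvdzP[l kE]|/prim[]]; [|exact: nAB..].
  by case/negP: sq1; apply/dvdzP; exists l; rewrite dE kE; ring.
have nB : ~ I B.
  move=> iB; apply: (nAB _ iB); case: (prim A A) => //.
  rewrite (_ : _ * _ = 4 * f_ a - (d * B) * B); last by rewrite fAB; ring.
  exact: subI.
pose V : {poly int} := 'X^4 + 2 * 'X^3 + 'X^2 + 2 * 'X + 1.
have iV : I V.
  (* Differentiating [4 f_a = A^2 + d B^2] and eliminating [A^2] leaves [d B (A'B - AB')], which is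
     [2 d B V]. *)
  have : I (2 * (d * (B * V))).
    rewrite (_ : _ * _ = (4 * deriv A) * f_ a - 2 * A * deriv (f_ a)).
      exact: subI.
    by rewrite f_deriv f_E /A /B /d /V !poly.derivE; ring.
  by case/prim => //; case/prim => // /prim[].
(* [x^2 R] is [f_a] modulo [V]. *)
pose R := (2 * a%:P + 1) * ('X^2 + 1) + (4 * a%:P - 2) * 'X.
have iX : ~ I 'X.
  move=> iX; apply: n1.
  rewrite (_ : 1 = 1 * V - ('X^3 + 2 * 'X^2 + 'X + 2) * 'X); last by rewrite /V; ring.
  exact: subI.
have iR : I R.
  have : I ('X * ('X * R)).
    rewrite (_ : _ * _ = 1 * f_ a - ('X^2 - 'X + 1) * V); last by rewrite f_E /V /R; ring.
    exact: subI.
  by do 2![case/prim => //].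
pose u : {poly int} := 2 * a%:P + 5.
(* Up to sign, [Q] is the resultant of [V / x^2] and [R / x] in [y = x + 1/x]. *)
have iQ : I (u ^+ 2 - 32).
  have : I ('X * ('X * (u ^+ 2 - 32))).
    rewrite (_ : _ * _ = ((2 * a%:P + 1) * ('X^2 + 1) + 4 * 'X) * R
      - (2 * a%:P + 1) ^+ 2 * V); last by rewrite /V /R /u; ring.
    exact: subI.
  by do 2![case/prim => //].
have QP : ((2 * a + 5) ^+ 2 - 32)%:P = u ^+ 2 - 32.
  by rewrite /u rmorphB rmorphXn rmorphD rmorphM /=; ring.
have /intI/dvdzP[k QE] : I ((2 * a + 5) ^+ 2 - 32)%:P by rewrite QP.
pose C := 4 * 'X^2 - (u - 4) * 'X + 4.
pose D := 2 * 'X^2 + (u - 2) * 'X + 2.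
pose E := 6 * 'X^2 + (10 - u) * 'X + 6.
have fCD : 32 * f_ a = (C * C) * D + (u ^+ 2 - 32) * ('X * ('X * E)).
  by rewrite f_E /C /D /E /u; ring.
have : I (C * (C * D)).
  rewrite (_ : _ * _ = 32 * f_ a - ('X * ('X * E)) * (u ^+ 2 - 32));
    last by rewrite fCD; ring.
  exact: subI.
have n32 : ~ I 32.
  by rewrite (_ : 32 = 2 * (2 * (2 * (2 * 2)))); [do 4![case/prim => //] | ring].
(* If [C] is in the ideal, [C^2] and hence [Q x^2 E] are in its square, so [(Q/p) x^2 E] is in the
   ideal. Now [p] does not divide [Q/p], and [E] is excluded because [C], [E] and [Q] would put
   [u + 8], then 32, in the ideal. *)
have CF : I C -> False.
  move=> iC.
  have : I (k%:P * ('X * ('X * E))).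
    apply: in_max2_cancel => //.
    rewrite (_ : _ * _ = 32 * f_ a - D * (C * C)).
      by apply: in_max2B; apply: in_max2Ml => //; exact: in_maxM2.
    by rewrite fCD -QP QE polyCM -natz polyC_natr; ring.
  case/prim => [/intI/dvdzP[l kE]|].
    by case/negP: sq2; apply/dvdzP; exists l; rewrite QE kE; ring.
  do 2![case/prim => //]; move=> iE.
  have : I ('X * (u + 8)).
    rewrite (_ : _ * _ = 2 * E - 3 * C); last by rewrite /E /C; ring.
    exact: subI.
  case/prim => // iu8; apply: n32.
  rewrite (_ : 32 = 1 * (u ^+ 2 - 32) - (u - 8) * (u + 8)); last by ring.
  exact: subI.
(* There remains [D]: with [R] and [Q] it puts [5u - 32], then [32 * 7], in the ideal. So 7 is in
   it, and as [5u - 32 = 10a - 7], so are [a] and [d = 8a + 7], which was excluded. *)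
case/prim => // /prim[//|iD].
have : I ('X * (2 * (5 * u - 32))).
  rewrite (_ : _ * _ = 1 * (2 * R - (u - 4) * D) - (- 'X) * (u ^+ 2 - 32));
    last by rewrite /D /R /u; ring.
  by apply: (subI _ _ 1) => //; exact: subI.
do 2![case/prim => //] => i5.
have : I (32 * 7).
  rewrite (_ : _ * _ = 25 * (u ^+ 2 - 32) - (5 * u + 32) * (5 * u - 32)); last by ring.
  exact: subI.
case/prim => // i7.
have i10 : I (2 * (5 * a%:P)).
  rewrite (_ : _ * _ = 1 * (5 * u - 32) - (-1) * 7); last by rewrite /u; ring.
  exact: subI.
case/prim: i10 => // /prim[i5'|ia].
  apply: n1; rewrite (_ : 1 = 3 * 5 - 2 * 7); last by ring.
  exact: subI.
apply: nd; rewrite (_ : d = 8 * a%:P - (-1) * 7); last by rewrite /d; ring.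
exact: subI.
Qed.

(** * Irreducibility *)

Lemma f_Poly a :
  f_ a = Poly [:: 1; 1; 2 * a + 1; 4 * a + 1; 2 * a + 1; 1; 1].
Proof.
apply/polyP => i; rewrite coef_Poly /f_ !coefD !coefCM !coefXn coefX coef1.
by do 7?[case: i => [|i] /=; first by ring]; rewrite nth_nil; ring.
Qed.

Lemma size_f a : size (f_ a) = 7%N.
Proof. by rewrite f_Poly (@PolyK _ 1). Qed.

Lemma f_monic a : f_ a \is monic.
Proof. by rewrite monicE lead_coefE size_f f_Poly coef_Poly. Qed.

Lemma mulz_eq1 (x y : int) : x * y = 1 -> x = 1 /\ y = 1 \/ x = -1 /\ y = -1.
Proof.
move=> xy; have := congr1 absz xy; rewrite abszM => /eqP.
rewrite muln_eq1 => /andP[/eqP x1 /eqP y1].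
have [x1'|x1'] : x = 1 \/ x = -1 by lia.
- by left; rewrite x1' in xy *; lia.
- by right; rewrite x1' in xy *; lia.
Qed.

(** The factor would be [x + 1] or [x - 1], but [f_a(-1) = 1] and [f_a(1) = 8a + 7] are nonzero. *)
Lemma f_no_factor1 (a z0 r0 r1 r2 r3 r4 : int) :
  z0 * r0 = 1 -> z0 * r1 + r0 = 1 -> z0 * r2 + r1 = 2 * a + 1 ->
  z0 * r3 + r2 = 4 * a + 1 -> z0 * r4 + r3 = 2 * a + 1 -> z0 + r4 = 1 -> False.
Proof. by move=> /mulz_eq1[] [-> ->]; lia. Qed.

Lemma f_no_factor2 (a z0 z1 r0 r1 r2 r3 : int) : 0 <= a ->
  z0 * r0 = 1 -> z0 * r1 + z1 * r0 = 1 -> z0 * r2 + z1 * r1 + r0 = 2 * a + 1 ->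
  z0 * r3 + z1 * r2 + r1 = 4 * a + 1 -> z0 + z1 * r3 + r2 = 2 * a + 1 ->
  z1 + r3 = 1 -> False.
Proof.
move=> a0 /mulz_eq1[] [-> ->] e1 e2 e3 e4 e5.
  have r1E : r1 = 1 - z1 by lia.
  have r3E : r3 = 1 - z1 by lia.
  have r2E : r2 = 2 * a - z1 + z1 * z1 by move: e4; rewrite r3E; lia.
  (* [z1^2] and [z1] have the same parity, so [r2] is even, and so is the coefficient of [x^3],
     against [4a + 1]. *)
  have [k kE] : exists k, z1 * z1 = z1 + 2 * k.
    have [k [->|->]] : exists k, z1 = 2 * k \/ z1 = 2 * k + 1.
    - by exists (z1 %/ 2)%Z; lia.
    - by exists (2 * k * k - k); ring.
    - by exists (2 * k * k + k); ring.
  have : 2 * (z1 * (a + k) - 2 * a - z1) = -1; last by lia.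
  have : z1 * (2 * a - z1 + z1 * z1) = z1 * (2 * a + 2 * k) by rewrite kE; ring.
  by move: e3; rewrite r1E r3E r2E; lia.
have r1E : r1 = - 1 - z1 by lia.
have r3E : r3 = 1 - z1 by lia.
have r2E : r2 = 2 * a + 2 - z1 + z1 * z1 by move: e4; rewrite r3E; lia.
(* The coefficient of [x^2] gives [z1^2 = -2a - 2]. *)
have := sqr_ge0 z1; rewrite expr2.
by move: e2; rewrite r1E r2E; lia.
Qed.

(** Completing the square in the coefficient of [x^4] makes [(2 z2 - 1)^2] equal to [1 - 8a] or
    [-7 - 8a], which is negative unless [a = 0] and [z0 = 1]. *)
Lemma f_no_factor3 (a z0 z1 z2 r0 r1 r2 : int) : 0 <= a ->
  z0 * r0 = 1 -> z0 * r1 + z1 * r0 = 1 -> z0 * r2 + z1 * r1 + z2 * r0 = 2 * a + 1 ->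
  z0 + z1 * r2 + z2 * r1 + r0 = 4 * a + 1 -> z1 + z2 * r2 + r1 = 2 * a + 1 ->
  z2 + r2 = 1 -> False.
Proof.
move=> a0 /mulz_eq1[] [-> ->] e1 e2 e3 e4 e5.
  have r1E : r1 = 1 - z1 by lia.
  have r2E : r2 = 1 - z2 by lia.
  have : (2 * z2 - 1) ^+ 2 = 1 - 8 * a.
    by rewrite expr2; move: e4; rewrite r1E r2E; lia.
  have [a1|a1] : a = 0 \/ 1 <= a by lia.
    (* Here [z1] and [z2] are 0 or 1, and the coefficient of [x^3] asks for
       [z1 (1 - z2) + z2 (1 - z1) = -1]. *)
    by move: e2 e3 e4; rewrite r1E r2E a1; nia.
  by have := sqr_ge0 (2 * z2 - 1); lia.
have r2E : r2 = 1 - z2 by lia.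
have : (2 * z2 - 1) ^+ 2 = - 7 - 8 * a.
  by rewrite expr2; move: e4; rewrite r2E; lia.
by have := sqr_ge0 (2 * z2 - 1); lia.
Qed.

Lemma f_no_monic_factor a (z r : {poly int}) : 0 <= a ->
  z \is monic -> r \is monic -> (1 < size z <= 4)%N -> f_ a <> z * r.
Proof.
move=> a0 /monicP zl /monicP rl zs fE.
have szr : (size z + size r).-1 = 7%N.
  by rewrite -size_mul -?lead_coef_eq0 ?zl ?rl // -fE size_f.
have sr : (size r = 8 - size z)%N by lia.
move: zl rl; rewrite !lead_coefE.
have cE k : (z * r)`_k = [:: 1; 1; 2 * a + 1; 4 * a + 1; 2 * a + 1; 1; 1]`_k.
  by rewrite -fE f_Poly coef_Poly.
have zn k : (size z <= k)%N -> z`_k = 0 by exact: nth_default.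
have rn k : (size r <= k)%N -> r`_k = 0 by exact: nth_default.
have e0 : z`_0 * r`_0 = 1.
  by have := cE 0%N; rewrite coefM !big_ord_recr big_ord0 /= add0r.
have e1 : z`_0 * r`_1 + z`_1 * r`_0 = 1.
  by have := cE 1%N; rewrite coefM !big_ord_recr big_ord0 /= add0r.
have e2 : z`_0 * r`_2 + z`_1 * r`_1 + z`_2 * r`_0 = 2 * a + 1.
  by have := cE 2; rewrite coefM !big_ord_recr big_ord0 /= add0r.
have e3 : z`_0 * r`_3 + z`_1 * r`_2 + z`_2 * r`_1 + z`_3 * r`_0 = 4 * a + 1.
  by have := cE 3; rewrite coefM !big_ord_recr big_ord0 /= add0r.
have e4 : z`_0 * r`_4 + z`_1 * r`_3 + z`_2 * r`_2 + z`_3 * r`_1 + z`_4 * r`_0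
    = 2 * a + 1.
  by have := cE 4; rewrite coefM !big_ord_recr big_ord0 /= add0r.
have e5 : z`_0 * r`_5 + z`_1 * r`_4 + z`_2 * r`_3 + z`_3 * r`_2 + z`_4 * r`_1
    + z`_5 * r`_0 = 1.
  by have := cE 5; rewrite coefM !big_ord_recr big_ord0 /= add0r.
rewrite sr {szr} in rn *.
case: (size z) zs zn rn => [|[|[|[|[|]]]]] //= _ zn rn zl rl.
- rewrite (zn 2) // (zn 3) // (zn 4) // (zn 5) // zl rl
    !mul0r ?mul1r ?mulr1 ?addr0 in e0 e1 e2 e3 e4 e5.
  exact: f_no_factor1 e0 e1 e2 e3 e4 e5.
- rewrite (zn 3) // (zn 4) // (zn 5) // (rn 5) // zl rl
    !mul0r ?mulr0 ?mul1r ?mulr1 ?addr0 ?add0r in e0 e1 e2 e3 e4 e5.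
  exact: f_no_factor2 a0 e0 e1 e2 e3 e4 e5.
- rewrite (zn 4) // (zn 5) // (rn 5) // (rn 4) // zl rl
    !mul0r ?mulr0 ?mul1r ?mulr1 ?addr0 ?add0r in e0 e1 e2 e3 e4 e5.
  exact: f_no_factor3 a0 e0 e1 e2 e3 e4 e5.
Qed.

(** The leading coefficients are both 1 or both -1; scaling both factors by this sign makes them
    monic. *)
Lemma f_no_factor a (z r : {poly int}) : 0 <= a ->
  (1 < size z <= 4)%N -> f_ a <> z * r.
Proof.
move=> a0 zs fE.
have lc : lead_coef z * lead_coef r = 1.
  by rewrite -lead_coefM -fE (monicP (f_monic a)).
have c2 : lead_coef z * lead_coef z = 1 by case/mulz_eq1: lc => [] [->].
have c0 : lead_coef z != 0 by case/mulz_eq1: lc => [] [->].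
have rz : lead_coef r = lead_coef z by case/mulz_eq1: lc => [] [-> ->].
apply: (@f_no_monic_factor a (lead_coef z *: z) (lead_coef z *: r)) => //.
- by rewrite monicE lead_coefZ c2.
- by rewrite monicE lead_coefZ rz c2.
- by rewrite size_scale.
- by rewrite -scalerAl -scalerAr scalerA c2 scale1r.
Qed.

(** By Gauss's lemma a divisor gives a factorization over Z, and unless one factor is constant, one
    of the two has degree from 1 to 3. *)
Lemma f_irreducible a : 0 <= a -> irreducible_poly (f_ a).
Proof.
move=> a0; split=> [|q q1 qf]; first by rewrite size_f.
have f0 : f_ a != 0 by rewrite monic_neq0 // f_monic.
rewrite -dvdp_size_eqp // size_f.
have [r fE] := dvdpP_int qf.
have q0 : q != 0 by apply: contraNneq f0 => q0; rewrite -dvd0p -q0.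
have sq : (0 < size q)%N by rewrite size_poly_gt0.
have szE : size (zprimitive q) = size q.
  by rewrite [in RHS](zpolyEprim q) size_scale // zcontents_eq0.
have [z0 r0] : zprimitive q != 0 /\ r != 0.
  by move: f0; rewrite fE mulf_eq0 negb_or => /andP.
have sr : (0 < size r)%N by rewrite size_poly_gt0.
have szr : (size q + size r).-1 = 7%N.
  by rewrite -szE -size_mul // -fE size_f.
have [] : (1 < size q <= 4)%N \/ (1 < size r <= 4)%N \/ size q = 7%N by lia.
- by rewrite -szE => /(@f_no_factor a _ r a0)[].
- case=> [|->//]; move=> /(@f_no_factor a _ (zprimitive q) a0)[].
  by rewrite mulrC.
Qed.

Theorem f_monogenic (a : int) : 0 <= a ->
  (forall p, prime p -> ~~ (p%:Z ^+ 2 %| 8 * a + 7)%Z) ->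
  (forall p, prime p -> ~~ (p%:Z ^+ 2 %| (2 * a + 5) ^+ 2 - 32)%Z) ->
  monogenic (f_ a).
Proof.
move=> a0 sq1 sq2.
apply: dedekind_criterion (f_monic a) (f_irreducible _ a0) _ => p p_pr.
have [->|p2] := eqVneq p 2; first exact: f_dedekind2.
by apply: f_dedekind_odd; [| | exact: sq1 | exact: sq2].
Qed.

(** * The lower bound *)

Lemma finite_bounded_int N : finite_set [set a : int | `|a| <= N%:Z].
Proof.
apply: sub_finite_set (finite_seq [seq i%:Z - N%:Z | i <- iota 0 (N + N).+1]).
move=> a; rewrite [X in X -> _]/= => aN; apply/mapP.
exists (absz (a + N%:Z)); last by lia.
by rewrite mem_iota; lia.
Qed.

Lemma leq_L_f (s : seq int) N : uniq s ->
  {in s, forall a, `|a| <= N%:Z /\ monogenic (f_ a)} -> (size s <= L_f N)%N.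
Proof.
move=> us sP; apply: uniq_leq_size => // a /sP aP.
(* Membership in [fset_set] is meaningful only for a finite set, whence the inclusion in a bounded
   interval. *)
rewrite in_fset_set ?inE //.
apply: sub_finite_set (finite_bounded_int N).
by move=> b /= [].
Qed.

Lemma good_monogenic N i : (i < N)%N -> good N i -> monogenic (f_ i.+1%:Z).
Proof.
have sqrZ (n : nat) : n%:Z ^+ 2 = (n ^ 2)%N by rewrite -mulnn PoszM expr2.
move=> iN gi; apply: f_monogenic => // p p_pr.
  have -> : 8 * i.+1%:Z + 7 = (8 * i + 15)%N%:Z by lia.
  by rewrite sqrZ; exact: good_linear gi p_pr.
have -> : (2 * i.+1%:Z + 5) ^+ 2 - 32 = ((2 * i + 7) ^ 2 - 32)%N%:Z.
  rewrite -subzn; last by rewrite (@leq_trans (7 ^ 2)) // leq_exp2r // leq_addl.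
  by rewrite -sqrZ; congr (_ ^+ 2 - _); lia.
by rewrite sqrZ; exact: good_quadratic gi p_pr.
Qed.

Lemma leq_count_good_L_f N : (count (good N) (iota 0 N) <= L_f N)%N.
Proof.
rewrite -size_filter -(size_map (fun i => i.+1%:Z)).
apply: leq_L_f.
  by rewrite map_inj_uniq ?filter_uniq ?iota_uniq // => i j [].
move=> a /mapP[i]; rewrite mem_filter mem_iota => /andP[gi /andP[_ iN]] ->.
by split; [lia | exact: good_monogenic gi].
Qed.

Theorem theorem1p10 (R : realType) :
  exists c : R, 0 < c /\
    \forall N \near \oo, c * (N%:R / ln N%:R) <= (L_f N)%:R.
Proof.
(* There are at least [(7N - 21000) / 100] good indices, which is at least [N / 20] once
   [N >= 10500]. *)
exists 20^-1; split; first by rewrite invr_gt0.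
near=> N.
have N0 : (105 * 100 <= N)%N by near: N; exact: nbhs_infty_ge.
(* From [N >= e] on, [ln N >= 1], so the linear bound implies the one with the logarithm. *)
have eN : expR 1 <= N%:R :> R by near: N; exact: nbhs_infty_ger.
have lnN : 1 <= ln N%:R :> R.
  by rewrite -[leLHS]expRK ler_ln ?posrE ?expR_gt0 // (lt_le_trans (expR_gt0 1) eN).
have NL : (N <= 20 * L_f N)%N.
  have := count_good N; have := leq_count_good_L_f N.
  by lia.
rewrite mulrC ler_pdivrMr // -natrM.
apply: (@le_trans _ _ N%:R); last by rewrite ler_nat mulnC.
by rewrite ler_pdivrMr ?(lt_le_trans _ lnN) // ler_peMr.
Unshelve. all: by end_near.
Qed.
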